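(* For the 2-server problem on the circle, the greedy algorithm (with any tie-breaking rule) is bijectively optimal: for every $n$ and every online algorithm $B$ there is a bijection $\pi:\mathcal{I}_n\to\mathcal{I}_n$ with $\textsc{greedy}(\sigma)\le B(\pi(\sigma))$ for all $\sigma\in\mathcal{I}_n$.
   Context: The continuous circle (of unit circumference) is modelled by a cycle whose vertices are equally spaced (all edges of equal, arbitrarily small length). Two servers occupy vertices; a request is a vertex, and an algorithm must move a server to the requested vertex; the cost is the total distance travelled by the servers. All algorithms start from the same given initial configuration. $\mathcal{I}_n$ is the set of all request sequences of length $n$ and $A(\sigma)$ is the cost of $A$ on $\sigma$. $\textsc{greedy}$ serves each request by moving the server closest to it (only that server moves). *)

(* Defs.v *)
From mathcomp Require Import all_boot all_order all_algebra.

Set Implicit Arguments.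
Unset Strict Implicit.
Unset Printing Implicit Defensive.

Import Order.TTheory GRing.Theory Num.Theory.

Local Open Scope ring_scope.

(* The vertices of the cycle are 0, ..., m-1 in cyclic order. Every edge has
   length 1/m, so that the circumference is 1; the distance between two
   vertices is the length of the shorter of the two arcs joining them. *)
Definition cdist (m : nat) (u v : 'I_m) : rat :=
  (minn `|u - v|%N (m - `|u - v|%N)%N)%:R / m%:R.

(* The positions of the two (labelled) servers. *)
Definition config (m : nat) := {ffun 'I_2 -> 'I_m}.

Definition move_cost (m : nat) (c d : config m) : rat :=
  \sum_(i < 2) cdist (c i) (d i).

(* [pos A s] is the configuration of A after it has served the requests s, in
   this order. It depends only on s, so A is online and deterministic; A may
   move both servers when it serves a request. *)
Record online_alg (m : nat) (c0 : config m) := OnlineAlg {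
  pos : seq 'I_m -> config m;
  pos_nil : pos [::] = c0;
  pos_serves : forall (s : seq 'I_m) (r : 'I_m),
    exists i : 'I_2, pos (rcons s r) i = r
}.

Definition cost (m : nat) (c0 : config m) (A : online_alg c0) (s : seq 'I_m)
    : rat :=
  \sum_(k < size s) move_cost (pos A (take k s)) (pos A (take k.+1 s)).

Definition move_server (m : nat) (c : config m) (i : 'I_2) (r : 'I_m)
    : config m :=
  [ffun j => if j == i then r else c j].

(* If the two servers are equidistant from r then either choice of i is
   allowed, and the choice may depend on the whole history (s, r). *)
Definition is_greedy (m : nat) (c0 : config m) (A : online_alg c0) : Prop :=
  forall (s : seq 'I_m) (r : 'I_m), exists i : 'I_2,
    (forall j : 'I_2, cdist (pos A s i) r <= cdist (pos A s j) r) /\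
    pos A (rcons s r) = move_server (pos A s) i r.

Lemma greedy_exists (m : nat) (c0 : config m) :
  exists A : online_alg c0, is_greedy A.
Proof.
pose near (c : config m) r : 'I_2 := [arg min_(i < ord0) cdist (c i) r]%O.
pose step c r := move_server c (near c r) r.
have srv s r : exists i : 'I_2, foldl step c0 (rcons s r) i = r.
  exists (near (foldl step c0 s) r).
  by rewrite foldl_rcons ffunE eqxx.
exists (@OnlineAlg m c0 (foldl step c0) erefl srv) => s r /=.
exists (near (foldl step c0 s) r); split; last by rewrite foldl_rcons.
by move=> j; rewrite /near; case: arg_minP => // i _; apply.
Qed.

(* Main.v *)
Require Import Defs.
From mathcomp Require Import all_boot all_order all_algebra.
From mathcomp Require Import zify lra.
Import Order.TTheory GRing.Theory Num.Theory.
Local Open Scope ring_scope.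

(* By induction on n, for every two histories after which the gaps (distances
   between the two servers) of greedy and of B differ by D, some bijection pi of
   the request sequences satisfies greedy(sigma) <= B(pi(sigma)) + D. An isometry
   of the circle sends the first server of greedy to that of B and the second one
   to within D of that of B; pi maps the first request r by this isometry. If the
   servers of greedy are at distances p and q from r, then greedy pays min(p, q)
   and has gap max(p, q) afterwards. If B pays M and has gap e afterwards, then
   the triangle inequality gives min(p, q) + |max(p, q) - e| <= M + D, whichever
   server B uses. *)

(** The numerator of [cdist], kept in [nat] so that [lia] can settle the case analyses on arcs. *)
Definition cycle_dist (m : nat) (u v : 'I_m) : nat :=
  minn `|u - v|%N (m - `|u - v|%N)%N.

Lemma cycle_dist_triangle (m : nat) (u v w : 'I_m) :
  (cycle_dist m u w <= cycle_dist m u v + cycle_dist m v w)%N.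
Proof.
by rewrite /cycle_dist; have := ltn_ord u; have := ltn_ord v;
  have := ltn_ord w; lia.
Qed.

Lemma cdistE (m : nat) (u v : 'I_m) : cdist u v = (cycle_dist m u v)%:R / m%:R.
Proof. by []. Qed.

Lemma cdistC (m : nat) (u v : 'I_m) : cdist u v = cdist v u.
Proof. by rewrite !cdistE /cycle_dist; do 2!f_equal; lia. Qed.

Lemma cdist_triangle (m : nat) (u v w : 'I_m) :
  cdist u w <= cdist u v + cdist v w.
Proof.
rewrite !cdistE -mulrDl ler_wpM2r ?invr_ge0 ?ler0n //.
by rewrite -natrD ler_nat cycle_dist_triangle.
Qed.

Lemma Zp_oppE (k : nat) (u : 'I_k.+1) :
  nat_of_ord (- u) = (if u == 0%N :> nat then 0 else k.+1 - u)%N.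
Proof.
have lt_u := ltn_ord u; rewrite /=; case: eqP => [->|u_neq0].
  by rewrite subn0 modnn.
by rewrite modn_small //; lia.
Qed.

Lemma Zp_subE (k : nat) (u v : 'I_k.+1) :
  nat_of_ord (u - v) = (if v <= u then u - v else u + k.+1 - v)%N.
Proof.
have lt_u := ltn_ord u; have lt_v := ltn_ord v.
rewrite /= modnDmr; case: leqP => [le_vu|lt_uv].
  have -> : (u + (k.+1 - v) = (u - v) + k.+1)%N by lia.
  by rewrite modnDr modn_small //; lia.
by rewrite modn_small //; lia.
Qed.

Lemma cycle_dist_sub (k : nat) (u v : 'I_k.+1) :
  cycle_dist k.+1 u v = cycle_dist k.+1 (u - v) 0.
Proof.
have lt_u := ltn_ord u; have lt_v := ltn_ord v.
by rewrite /cycle_dist Zp_subE /=; case: leqP => ?; lia.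
Qed.

Lemma cycle_dist_opp (k : nat) (u : 'I_k.+1) :
  cycle_dist k.+1 (- u) 0 = cycle_dist k.+1 u 0.
Proof.
have lt_u := ltn_ord u.
by rewrite /cycle_dist Zp_oppE /=; case: eqP => ?; lia.
Qed.

(** One of [a] and its mirror image [- a] lies on the same half circle from 0 as [b]; on one half,
    distances are differences of distances from 0. *)
Lemma cycle_dist_align (k : nat) (a b : 'I_k.+1) :
  let D := `|cycle_dist k.+1 a 0%R - cycle_dist k.+1 b 0%R|%N in
  (cycle_dist k.+1 a b <= D)%N \/ (cycle_dist k.+1 (- a) b <= D)%N.
Proof.
have lt_a := ltn_ord a; have lt_b := ltn_ord b.
by rewrite /cycle_dist Zp_oppE /=; case: eqP => ?; lia.
Qed.

Lemma isometry_align_nat (m : nat) (x y x' y' : 'I_m) :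
  exists phi : 'I_m -> 'I_m,
    [/\ forall u v, cycle_dist m (phi u) (phi v) = cycle_dist m u v,
        phi x = x' &
        (cycle_dist m (phi y) y'
           <= `|cycle_dist m x y - cycle_dist m x' y'|)%N].
Proof.
case: m x y x' y' => [[] //|k] x y x' y'.
have flip u v : cycle_dist k.+1 u v = cycle_dist k.+1 (v - u) 0.
  by rewrite cycle_dist_sub -cycle_dist_opp opprB.
have cancel (u v w : 'I_k.+1) : (w + u) - (w + v) = u - v.
  by rewrite opprD addrACA subrr add0r.
have translate (u v w : 'I_k.+1) : cycle_dist k.+1 (w + u) v =
    cycle_dist k.+1 u (v - w).
  by rewrite cycle_dist_sub [RHS]cycle_dist_sub opprB addrCA addrA.
rewrite (flip x) (flip x').
(* Seen from [x] and [x'], the other points are [y - x] and [y' - x']. The first case yields a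
   rotation, the second a reflection. *)
have [le_D|le_D] := cycle_dist_align k (y - x) (y' - x').
  exists (fun r => x' + (r - x)); split=> [u v||].
  - rewrite cycle_dist_sub cancel [RHS]cycle_dist_sub.
    by rewrite ![_ - x]addrC cancel.
  - by rewrite subrr addr0.
  - by rewrite translate; exact: le_D.
exists (fun r => x' + - (r - x)); split=> [u v||].
- rewrite cycle_dist_sub cancel [RHS]cycle_dist_sub.
  by rewrite -opprD cycle_dist_opp ![_ - x]addrC cancel.
- by rewrite subrr subr0.
- by rewrite translate; exact: le_D.
Qed.

Lemma isometry_align (m : nat) (x y x' y' : 'I_m) :
  exists phi : 'I_m -> 'I_m,
    [/\ injective phi,
        forall u v, cdist (phi u) (phi v) = cdist u v,
        phi x = x' &
        cdist (phi y) y' <= `|cdist x y - cdist x' y'|].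
Proof.
have [phi [iso phix phiy]] := isometry_align_nat _ x y x' y'.
exists phi; split=> //.
(* Equal images force distance 0, and since [|u - v| < m] this means [u = v]. *)
- move=> u v phi_eq; apply: val_inj => /=; have := iso u v.
  rewrite phi_eq /cycle_dist.
  have := ltn_ord u; have := ltn_ord v; have := ltn_ord (phi v); lia.
- by move=> u v; rewrite !cdistE iso.
rewrite !cdistE -mulrBl normrM (ger0_norm (x := m%:R^-1)) ?invr_ge0 ?ler0n //.
rewrite ler_wpM2r ?invr_ge0 ?ler0n //.
have [le|/ltnW le] := leqP (cycle_dist m x' y') (cycle_dist m x y).
  by rewrite -natrB // normr_nat ler_nat; lia.
by rewrite distrC -natrB // normr_nat ler_nat; lia.
Qed.

Definition gap (m : nat) (c : config m) : rat := cdist (c ord0) (c ord_max).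

(** An algorithm may use its whole history, so an induction that peels requests off the front has to
    carry [h]. *)
Definition cost_from (m : nat) (c0 : config m) (A : online_alg c0)
    (h s : seq 'I_m) : rat :=
  \sum_(k < size s) move_cost (pos A (h ++ take k s)) (pos A (h ++ take k.+1 s)).

Lemma cost_from_cons (m : nat) (c0 : config m) (A : online_alg c0)
    (h s : seq 'I_m) (r : 'I_m) :
  cost_from m c0 A h (r :: s) =
    move_cost (pos A h) (pos A (rcons h r)) + cost_from m c0 A (rcons h r) s.
Proof.
rewrite /cost_from /= big_ord_recl /= take0 cats0 cats1; congr (_ + _).
by apply: eq_bigr => k _; rewrite -!cat_rcons.
Qed.

Lemma ord2P (i : 'I_2) : i = ord0 \/ i = ord_max.
Proof. by case: i => [[|[|//]] hi]; [left|right]; apply: val_inj. Qed.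

Lemma move_cost2 (m : nat) (c d : config m) :
  move_cost c d = cdist (c ord0) (d ord0) + cdist (c ord_max) (d ord_max).
Proof.
rewrite /move_cost big_ord_recl big_ord1; congr (_ + cdist (c _) (d _));
  exact: val_inj.
Qed.

Lemma cdistxx (m : nat) (u : 'I_m) : cdist u u = 0.
Proof. by rewrite cdistE /cycle_dist distnn min0n mul0r. Qed.

(** The nearer server ends at [r] and the farther one stays, so its distance to [r] is the new gap;
    in a tie both choices give the same values. *)
Lemma greedy_step (m : nat) (c0 : config m) (G : online_alg c0)
    (h : seq 'I_m) (r : 'I_m) : is_greedy G ->
  let p := cdist (pos G h ord0) r in
  let q := cdist (pos G h ord_max) r in
  move_cost (pos G h) (pos G (rcons h r)) = Num.min p q /\
  gap m (pos G (rcons h r)) = Num.max p q.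
Proof.
move=> hG p q; have [i [near ->]] := hG h r.
rewrite move_cost2 /gap !ffunE.
have [E|E] := ord2P i; rewrite E in near *; rewrite ?eqxx /= !cdistxx.
  have le_pq : p <= q := near ord_max.
  by rewrite addr0 (min_l le_pq) (max_r le_pq) [cdist r _]cdistC.
have le_qp : q <= p := near ord0.
by rewrite add0r (min_r le_qp) (max_l le_qp).
Qed.

(** The server that reaches [r] pays its distance to [r]; the other changes its distance to [r] into
    the new gap, and pays at least that change. *)
Lemma serve_step (m : nat) (c d : config m) (r : 'I_m) :
  (exists i : 'I_2, d i = r) ->
  let p := cdist (c ord0) r in let q := cdist (c ord_max) r in
  p + `|gap m d - q| <= move_cost c d \/ q + `|gap m d - p| <= move_cost c d.
Proof.
case=> i di p q; rewrite move_cost2 /gap; have [E|E] := ord2P i.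
  left; rewrite /p /q -di E lerD2l ler_norml.
  have := cdist_triangle _ (d ord0) (d ord_max) (c ord_max).
  have := cdist_triangle _ (d ord0) (c ord_max) (d ord_max).
  rewrite !(cdistC _ (d ord_max) (c ord_max)) !(cdistC _ (d ord0) (c ord_max)).
  lra.
right; rewrite /p /q -di E addrC lerD2r ler_norml.
have := cdist_triangle _ (d ord0) (c ord0) (d ord_max).
have := cdist_triangle _ (c ord0) (d ord0) (d ord_max).
rewrite !(cdistC _ (d ord0) (c ord0)).
lra.
Qed.

(** Both [p + |e - q|] and [q + |e - p|] are at least [min + |max - e|]: swapping the roles of [p]
    and [q] changes each term by at most [|p - q|]. Replacing [q] by [q'] then costs at most [D]. *)
Lemma discrepancy_step (p q q' e D M : rat) :
  `|q - q'| <= D -> p + `|e - q'| <= M \/ q' + `|e - p| <= M ->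
  Num.min p q + `|Num.max p q - e| <= M + D.
Proof.
have abs_ge (x : rat) : x <= `|x| /\ - x <= `|x|.
  by rewrite ler_norm ler_normr lexx orbT.
move: (abs_ge (q - q')) (abs_ge (e - q')) (abs_ge (e - p)).
by move=> [? ?] [? ?] [? ?] ? [|] ?; have [?|?] := leP p q;
  rewrite -lerBrDl ler_norml; lra.
Qed.

(** The histories are independent because [r] and its image differ in general; the difference of
    gaps acts as a potential. *)
Lemma greedy_vs_online (m : nat) (c0 c1 : config m)
    (G : online_alg c0) (B : online_alg c1) (n : nat) (h h' : seq 'I_m) :
  is_greedy G ->
  exists2 pi : n.-tuple 'I_m -> n.-tuple 'I_m, injective pi &
    forall s : n.-tuple 'I_m,
      cost_from m c0 G h s <=
        cost_from m c1 B h' (pi s) + `|gap m (pos G h) - gap m (pos B h')|.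
Proof.
move=> hG; elim: n h h' => [|n IHn] h h'.
  exists id => // s; rewrite tuple0 /cost_from !big_ord0 add0r.
  exact: normr_ge0.
have [phi [phi_inj iso phix phiy]] := isometry_align m
  (pos G h ord0) (pos G h ord_max) (pos B h' ord0) (pos B h' ord_max).
(* The bijection on the remaining requests may depend on the first one, [r]. *)
have /fin_all_exists2[P P_inj P_le] r := IHn (rcons h r) (rcons h' (phi r)).
exists (fun s => [tuple of phi (thead s) :: P (thead s) [tuple of behead s]]).
  move=> s t; case/tupleP: s => r s; case/tupleP: t => r' t.
  rewrite !theadE => /(congr1 val) [] /phi_inj <- /val_inj /P_inj eq_st.
  by apply: val_inj; congr (_ :: _); move/(congr1 val): eq_st.
move=> s; case/tupleP: s => r s; rewrite theadE.
have -> : [tuple of behead [tuple of r :: s]] = s by apply: val_inj.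
rewrite /= !cost_from_cons; have /= := P_le r s.
have [-> ->] := greedy_step m c0 G h r hG.
set D := `|gap m (pos G h) - _|; set e := gap m (pos B (rcons h' _)).
set M := move_cost (pos B h') _; set q := cdist (pos G h ord_max) r.
set q' := cdist (pos B h' ord_max) (phi r).
(* As [phi] sends the first server of greedy exactly to that of [B], both are equally far from their
   requests. *)
have serve : cdist (pos G h ord0) r + `|e - q'| <= M \/
    q' + `|e - cdist (pos G h ord0) r| <= M.
  by rewrite -iso phix; apply: serve_step; apply: pos_serves.
have q_close : `|q - q'| <= D.
  apply: le_trans phiy; rewrite /q /q' -iso ler_norml.
  have := cdist_triangle _ (phi (pos G h ord_max)) (pos B h' ord_max) (phi r).
  have := cdist_triangle _ (pos B h' ord_max) (phi (pos G h ord_max)) (phi r).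
  by rewrite (cdistC _ (pos B h' ord_max) (phi (pos G h ord_max))); lra.
by have := discrepancy_step _ _ _ _ _ _ q_close serve; lra.
Qed.

Theorem theorem2 (m : nat) (hm : (2 < m)%N) (c0 : config m)
    (G : online_alg c0) (hG : is_greedy G) (n : nat) (B : online_alg c0) :
  exists pi : n.-tuple 'I_m -> n.-tuple 'I_m,
    bijective pi /\
    (forall sigma : n.-tuple 'I_m, cost G sigma <= cost B (pi sigma)).
Proof.
(* With empty histories both algorithms are at [c0], so the potential is 0. *)
have [pi pi_inj pi_le] := greedy_vs_online m c0 c0 G B n [::] [::] hG.
exists pi; split=> [|s]; first exact: injF_bij.
by have := pi_le s; rewrite !pos_nil subrr normr0 addr0.
Qed.
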